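(* Let $0\le\delta<\rho\le1$ and $m<-(n+1)$. Let $a:\mathbb{T}^n\times\mathbb{Z}^n\to\mathbb{C}$ be a symbol such that for all $\alpha,\beta\in\mathbb{N}_0^n$ there is a constant $C_{\alpha,\beta}>0$ with $$|\partial_x^\beta\triangle_\xi^\alpha a(x,\xi)|\le C_{\alpha,\beta}\langle\xi\rangle^{m-\rho|\alpha|+\delta|\beta|}\qquad\text{for all }x\in\mathbb{T}^n,\ \xi\in\mathbb{Z}^n .$$ Let $\phi:\mathbb{T}^n\times\mathbb{Z}^n\to\mathbb{R}$ be a phase function such that $x\mapsto e^{2\pi i\phi(x,\xi)}$ is 1-periodic for all $\xi\in\mathbb{Z}^n$, and such that there is a constant $C>0$ with $|\partial_x^\alpha\phi(x,\xi)|\le C$ for all $\alpha\in\mathbb{N}_0^n$, $x\in\mathbb{T}^n$, $\xi\in\mathbb{Z}^n$. Let $p(\cdot)\in C^{\log}_{loc}(\mathbb{T}^n)$ with $1<p_-\le p_+<\infty$, and suppose that $p(x)=p_\infty$ for $|x|\ge R$, where $R>0$ and $p_\infty$ is a constant. Let $w\in A_{p(\cdot)}$ be a weight of the form $$w(x)=(1+|x|)^{\beta}\prod_{k=1}^{n}|x-x_k|^{\beta_k},\qquad x_1,\dots,x_n\in\mathbb{T}^n,\quad \beta,\beta_1,\dots,\beta_n\in\mathbb{R},$$ such that $$-\frac{n}{p(x_k)}<\beta_k<\frac{n}{p'(x_k)}\quad(k=1,\dots,n)\qquad\text{and}\qquad -\frac{n}{p_\infty}<\beta+\sum_{k=1}^{n}\beta_k<\frac{n}{p'_\infty}.$$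 Then the periodic Fourier integral operator $$Af(x)=\sum_{\xi\in\mathbb{Z}^n}e^{2\pi i\phi(x,\xi)}a(x,\xi)\,\hat f(\xi),\qquad f\in C^\infty(\mathbb{T}^n),$$ is bounded on $L^{p(\cdot)}_w(\mathbb{T}^n)$: there exists a constant $C'>0$ such that $\|Af\|_{L^{p(\cdot)}_w(\mathbb{T}^n)}\le C'\|f\|_{L^{p(\cdot)}_w(\mathbb{T}^n)}$ for all $f\in C^\infty(\mathbb{T}^n)$.
   Context: $\mathbb{T}^n=\mathbb{R}^n/\mathbb{Z}^n$ is identified with the cube $[0,1)^n$ with Lebesgue measure, and $|x|$, $|x-x_k|$ are Euclidean norms of points of this cube; functions on $\mathbb{T}^n$ are identified with 1-periodic functions on $\mathbb{R}^n$, where $g$ is 1-periodic if $g(x+l)=g(x)$ for all $x\in\mathbb{R}^n$, $l\in\mathbb{Z}^n$. The Fourier transform is $\hat f(\xi)=(\mathcal{F}_{\mathbb{T}^n}f)(\xi)=\int_{\mathbb{T}^n}e^{-2\pi i x\cdot\xi}f(x)\,dx$, $\xi\in\mathbb{Z}^n$. $\langle\xi\rangle=(1+|\xi|^2)^{1/2}$. Difference operators: with $(\delta_j)_{1\le j\le n}$ the canonical basis of $\mathbb{R}^n$, $\triangle_{\xi_j}a(\xi)=a(\xi+\delta_j)-a(\xi)$ and $\triangle_\xi^\alpha=\triangle_{\xi_1}^{\alpha_1}\cdots\triangle_{\xi_n}^{\alpha_n}$. A symbol $a(x,\xi)$ is $C^\infty$ in $x\in\mathbb{T}^n$ for each $\xi\in\mathbb{Z}^n$.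 A phase function $\phi(x,\xi)$ is a real-valued function, here smooth in $x$, that is positively homogeneous of degree 1 in $\xi\ne0$, i.e. $\phi(x,t\xi)=t\phi(x,\xi)$ whenever $t>0$ and $\xi,t\xi\in\mathbb{Z}^n\setminus\{0\}$. Only $x\mapsto e^{2\pi i\phi(x,\xi)}$ is required to be 1-periodic in $x$. $\mathcal{P}(\mathbb{T}^n)$ is the set of measurable 1-periodic functions $p(\cdot):\mathbb{T}^n\to(0,\infty]$; $p_-=\operatorname{ess\,inf}_{\mathbb{T}^n}p$, $p_+=\operatorname{ess\,sup}_{\mathbb{T}^n}p$, and $p'(\cdot)$ is defined by $\frac1{p(x)}+\frac1{p'(x)}=1$ (similarly $p'_\infty$ is the conjugate exponent of $p_\infty$). $p\in C^{\log}_{loc}(\mathbb{T}^n)$ means $p\in\mathcal{P}(\mathbb{T}^n)$ and there is $c_{\log}(p)>0$ with $|p(x)-p(y)|\le\frac{c_{\log}(p)}{-\log|x-y|}$ for all $x\neq y$ in $\mathbb{T}^n$ with $|x-y|\le\frac12$. $L^{p(\cdot)}(\mathbb{T}^n)$ is the space of measurable 1-periodic $f$ such that $\varrho_{p(\cdot)}(f/\lambda)<\infty$ for some $\lambda>0$, where $\varrho_{p(\cdot)}(g)=\int_{\mathbb{T}^n}|g(x)|^{p(x)}\,dx$, with Luxemburg norm $\|f\|_{L^{p(\cdot)}(\mathbb{T}^n)}=\inf\{\lambda>0:\varrho_{p(\cdot)}(f/\lambda)\le1\}$. The weighted space $L^{p(\cdot)}_w(\mathbb{T}^n)$ has norm $\|f\|_{L^{p(\cdot)}_w(\mathbb{T}^n)}=\|wf\|_{L^{p(\cdot)}(\mathbb{T}^n)}$.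 The variable-exponent Muckenhoupt class $A_{p(\cdot)}$ consists of the weights $w$ (non-negative, in $L^1_{loc}(\mathbb{T}^n)$) with $\sup_Q|Q|^{-1}\|w\chi_Q\|_{L^{p(\cdot)}(\mathbb{T}^n)}\|w^{-1}\chi_Q\|_{L^{p'(\cdot)}(\mathbb{T}^n)}<\infty$, the supremum being over cubes $Q$ in $\mathbb{T}^n$. *)

(* Defs.v *)
From HB Require Import structures.
From mathcomp Require Import all_boot all_order all_algebra.
From mathcomp Require Import complex.
From mathcomp Require Import all_classical all_reals all_analysis.
From mathcomp Require Import measurable_realfun ess_sup_inf.

Set Implicit Arguments.
Unset Strict Implicit.
Unset Printing Implicit Defensive.

Import Order.TTheory GRing.Theory Num.Theory.
Import numFieldNormedType.Exports.

Local Open Scope classical_set_scope.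
Local Open Scope ring_scope.
Local Open Scope complex_scope.

Section RowVectorMeasurable.
Variables (R : realType) (n : nat).

Let coord (i : 'I_n) (x : 'rV[R]_n) : R := x 0 i.

Let rV_set0 : g_sigma_preimage coord set0.
Proof. exact: sigma_algebra0. Qed.

Let rV_setC A : g_sigma_preimage coord A -> g_sigma_preimage coord (~` A).
Proof. exact: sigma_algebraC. Qed.

Let rV_bigcup (F : (set 'rV[R]_n)^nat) :
  (forall i, g_sigma_preimage coord (F i)) ->
  g_sigma_preimage coord (\bigcup_i F i).
Proof. exact: sigma_algebra_bigcup. Qed.

(* The Borel sigma-algebra of R^n, generated by the coordinates. *)
HB.instance Definition _ :=
  @isMeasurable.Build (measure_tuple_display default_measure_display) 'rV[R]_n
    (g_sigma_preimage coord) rV_set0 rV_setC rV_bigcup.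

Lemma measurable_coord (i : 'I_n) :
  measurable_fun [set: 'rV[R]_n] (fun x : 'rV[R]_n => x 0 i).
Proof.
move=> _ Y mY; rewrite setTI; apply: sub_sigma_algebra => /=.
rewrite -bigcup_seq/=; exists i => /=; first by rewrite mem_index_enum.
by exists Y => //; rewrite setTI.
Qed.

Lemma measurable_fun_rV d (T : measurableType d) (f : T -> 'rV[R]_n) :
  (forall i, measurable_fun [set: T] (fun t => f t 0 i)) ->
  measurable_fun [set: T] f.
Proof.
move=> mf.
have sub : g_sigma_preimage (fun i => coord i \o f) `<=` measurable.
  apply: smallest_sub; first exact: sigma_algebra_measurable.
  rewrite -bigcup_seq/=; apply: bigcup_sub => i _.
  by move=> A [B mB <-]; exact: mf.
move: sub; rewrite g_sigma_preimage_comp => sub _ B mB.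
by apply: sub; exists B.
Qed.

End RowVectorMeasurable.

(* T^n is identified with the cube [0,1)^n, and a function on T^n with a
   1-periodic function on R^n. *)

Section TorusMeasure.
Variable R : realType.

Definition unit_interval_measure : set (measurableTypeR R) -> \bar R :=
  mrestr (@lebesgue_measure R) (measurable_itv `[0%R, 1%R[).

HB.instance Definition _ := Measure.on unit_interval_measure.

Let unit_interval_measureT : unit_interval_measure setT = 1%E.
Proof.
rewrite /unit_interval_measure /mrestr setTI lebesgue_measure_itv/= lte01.
by rewrite oppr0 adde0.
Qed.

HB.instance Definition _ :=
  Measure_isProbability.Build _ _ _ unit_interval_measure unit_interval_measureT.

(* (t, x) |-> the row vector (t, x_0, ..., x_{n-1}) *)
Definition rV_cons n (z : measurableTypeR R * 'rV[R]_n) : 'rV[R]_n.+1 :=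
  row_mx (const_mx z.1 : 'rV[R]_1) z.2.

Let measurable_rV_cons n : measurable_fun setT (@rV_cons n).
Proof.
apply: measurable_fun_rV => i; rewrite /rV_cons.
case: (fintype.splitP (i : 'I_(1 + n))) => j ij.
  have -> : i = lshift n j by exact/val_inj.
  rewrite [X in measurable_fun _ X](_ : _ = fst); first exact: measurable_fst.
  by apply/funext => z /=; rewrite (@row_mxEl _ 1 1 n) mxE.
have -> : i = rshift 1 j by exact/val_inj.
rewrite [X in measurable_fun _ X](_ : _ = (fun x : 'rV[R]_n => x 0 j) \o snd).
  exact: measurableT_comp (@measurable_coord R n j) measurable_snd.
by apply/funext => z /=; rewrite (@row_mxEr _ 1 1 n).
Qed.

HB.instance Definition _ n :=
  @isMeasurableFun.Build _ _ _ _ (@rV_cons n) (@measurable_rV_cons n).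

(* Lebesgue measure on R^n restricted to [0,1)^n, as an n-fold product; its
   values on boxes are given by torus_measure_box. *)
Fixpoint torus_measure (n : nat) : probability 'rV[R]_n R :=
  if n is n'.+1
  then distribution (unit_interval_measure \x torus_measure n')%E (@rV_cons n')
  else \d_(0 : 'rV[R]_0).

End TorusMeasure.
Arguments torus_measure {R n}.

Section TorusMeasureBox.
Variable R : realType.

Lemma torus_measure_box n (a b : 'I_n -> R) :
  (forall j, 0 <= a j /\ a j <= b j /\ b j <= 1) ->
  torus_measure [set x : 'rV[R]_n | forall j, a j <= x 0 j < b j] =
  (\prod_j (b j - a j))%:E.
Proof.
elim: n a b => [|n IHn] a b ab.
  rewrite big_ord0 /= diracE mem_set//; by case.
rewrite big_ord_recl EFinM /= /distribution /pushforward.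
rewrite -IHn; last by move=> j; exact: ab.
set B := [set x : 'rV[R]_n | _].
have -> : @rV_cons R n @^-1` [set x | forall j, a j <= x 0 j < b j] =
    [set` `[a ord0, b ord0[] `*` B.
  apply/seteqP; split=> z /=.
    move=> zab; split=> /=.
      have := zab ord0; rewrite in_itv/= /rV_cons.
      have -> : ord0 = lshift n (ord0 : 'I_1) by exact/val_inj.
      by rewrite (@row_mxEl _ 1 1 n) mxE.
    move=> j; have := zab (lift ord0 j); rewrite /rV_cons.
    have -> : lift ord0 j = rshift 1 j :> 'I_(1 + n) by exact/val_inj.
    by rewrite (@row_mxEr _ 1 1 n).
  rewrite in_itv/= => -[z1 z2] j; rewrite /rV_cons.
  case: (unliftP ord0 j) => [k ->|->].
    have := z2 k.
    have -> : lift ord0 k = rshift 1 k :> 'I_(1 + n) by exact/val_inj.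
    by rewrite (@row_mxEr _ 1 1 n).
  move: z1.
  have -> : ord0 = lshift n (ord0 : 'I_1) by exact/val_inj.
  by rewrite (@row_mxEl _ 1 1 n) mxE.
have mB : measurable B.
  rewrite (_ : B = \bigcap_(j in [set: 'I_n])
      (fun x : 'rV[R]_n => x 0 j) @^-1` [set` `[a (lift ord0 j), b (lift ord0 j)[]).
    apply: fin_bigcap_measurable => // j _; rewrite -[X in measurable X]setTI.
    by apply: (@measurable_coord R n j) => //; exact: measurable_itv.
  apply/seteqP; split=> x /=.
    by move=> xB j _ /=; rewrite in_itv /=; exact: xB.
  by move=> xB j; have := xB j Logic.I; rewrite /= in_itv.
rewrite product_measure1E//.
congr (_ * _)%E.
rewrite [LHS](_ : _ = lebesgue_measure (`[a ord0, b ord0[ `&` `[0, 1[))//.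
have [a0 [ab0 b1]] := ab ord0.
rewrite setIidl; last first.
  move=> x /=; rewrite !in_itv/= => /andP[ax xb].
  by rewrite (le_trans a0 ax) (lt_le_trans xb b1).
rewrite lebesgue_measure_itv/= lte_fin.
have [//|ba] := ltP (a ord0) (b ord0).
by have -> : a ord0 = b ord0; [exact/le_anti/andP|rewrite subrr].
Qed.

End TorusMeasureBox.

Section Torus.
Variables (R : realType) (n : nat).

Definition unit_cube : set 'rV[R]_n := [set x | forall j, 0 <= x 0 j < 1].

Definition one_periodic (U : Type) (g : 'rV[R]_n -> U) :=
  forall (x : 'rV[R]_n) (l : 'rV[int]_n), g (x + map_mx intr l) = g x.

(* The Euclidean norm; the library's norm on 'rV[R]_n is the sup norm. *)
Definition enorm (x : 'rV[R]_n) : R := Num.sqrt (\sum_j x 0 j ^+ 2).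

Definition dot (x : 'rV[R]_n) (xi : 'rV[int]_n) : R :=
  \sum_j x 0 j * (xi 0 j)%:~R.

Definition japanese (xi : 'rV[int]_n) : R :=
  Num.sqrt (1 + enorm (map_mx intr xi) ^+ 2).

End Torus.
Arguments unit_cube {R n}.
Arguments japanese {R n} xi.

Section Derivatives.
Variables (R : realType) (n : nat).
Implicit Types (f : 'rV[R]_n -> R) (g : 'rV[R]_n -> R[i]).

Definition partial (j : 'I_n) f : 'rV[R]_n -> R := 'D_(delta_mx 0 j) f.

(* Partial derivatives of all orders exist and are continuous. *)
Definition smooth f := forall s : seq 'I_n,
  continuous (foldr partial f s) /\
  forall (j : 'I_n) (x : 'rV[R]_n),
    derivable (foldr partial f s) x (delta_mx 0 j).

Definition csmooth g :=
  smooth (fun x => complex.Re (g x)) /\ smooth (fun x => complex.Im (g x)).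

Definition mlength (b : 'I_n -> nat) : nat := (\sum_j b j)%N.

Definition mderiv (b : 'I_n -> nat) f : 'rV[R]_n -> R :=
  foldr (fun j h => iter (b j) (partial j) h) f (enum 'I_n).

Definition cmderiv (b : 'I_n -> nat) g (x : 'rV[R]_n) : R[i] :=
  mderiv b (fun y => complex.Re (g y)) x +i*
  mderiv b (fun y => complex.Im (g y)) x.

Definition fdiff (j : 'I_n) (c : 'rV[int]_n -> R[i]) (xi : 'rV[int]_n) : R[i] :=
  c (xi + delta_mx 0 j) - c xi.

Definition mdiff (b : 'I_n -> nat) (c : 'rV[int]_n -> R[i]) :
    'rV[int]_n -> R[i] :=
  foldr (fun j h => iter (b j) (fdiff j) h) c (enum 'I_n).

End Derivatives.

Section FourierIntegralOperator.
Variables (R : realType) (n : nat).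
Implicit Types (a : 'rV[R]_n -> 'rV[int]_n -> R[i]).
Implicit Types (phi : 'rV[R]_n -> 'rV[int]_n -> R).

Definition cmod (z : R[i]) : R := ComplexField.Normc.normc z.

Definition expi (t : R) : R[i] := cos t +i* sin t.

Definition symbol_class (m rho delta : R) a :=
  [/\ forall xi, one_periodic (a ^~ xi),
      forall xi, csmooth (a ^~ xi) &
      forall alpha beta : 'I_n -> nat, exists2 C : R, 0 < C &
        forall x xi, unit_cube x ->
          cmod (cmderiv beta (fun y => mdiff alpha (a y) xi) x) <=
          C * japanese xi `^
              (m - rho * (mlength alpha)%:R + delta * (mlength beta)%:R)].

(* phi need not be periodic, so it is a function on all of R^n x Z^n; its
   homogeneity is required for x in [0,1)^n only. *)
Definition phase_function phi :=
  (forall xi, smooth (phi ^~ xi)) /\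
  (forall (x : 'rV[R]_n) (t : R) (xi eta : 'rV[int]_n),
     unit_cube x -> 0 < t -> xi != 0 -> eta != 0 ->
     map_mx intr eta = t *: map_mx intr xi ->
     phi x eta = t * phi x xi).

Definition smooth_torus (f : 'rV[R]_n -> R[i]) := one_periodic f /\ csmooth f.

Definition cintegral (g : 'rV[R]_n -> R[i]) : R[i] :=
  fine (\int[torus_measure]_x (complex.Re (g x))%:E)%E +i*
  fine (\int[torus_measure]_x (complex.Im (g x))%:E)%E.

Definition fourier (f : 'rV[R]_n -> R[i]) (xi : 'rV[int]_n) : R[i] :=
  cintegral (fun x => expi (- (2 * pi * dot x xi)) * f x).

(* Unordered sum of an absolutely summable family. *)
Definition rsum (F : 'rV[int]_n -> R) : R :=
  fine (\esum_(xi in setT) (EFin \o F)^\+ xi)%E -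
  fine (\esum_(xi in setT) (EFin \o F)^\- xi)%E.

Definition csum (F : 'rV[int]_n -> R[i]) : R[i] :=
  rsum (fun xi => complex.Re (F xi)) +i* rsum (fun xi => complex.Im (F xi)).

Definition fio phi a (f : 'rV[R]_n -> R[i]) (x : 'rV[R]_n) : R[i] :=
  csum (fun xi => expi (2 * pi * phi x xi) * a x xi * fourier f xi).

End FourierIntegralOperator.

Section VariableExponent.
Variables (R : realType) (n : nat).
Implicit Types (p : 'rV[R]_n -> \bar R) (w : 'rV[R]_n -> R).
Local Open Scope ereal_scope.

Definition torus_exponent p :=
  [/\ measurable_fun [set: 'rV[R]_n] p, one_periodic p & forall x, 0 < p x].

Definition log_hoelder p := torus_exponent p /\
  exists2 c : R, (0 < c)%R & forall x y,
    unit_cube x -> unit_cube y -> x != y -> (enorm (x - y) <= 2^-1)%R ->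
    `|p x - p y| <= (c / - ln (enorm (x - y)))%:E.

(* s ^ q for s >= 0, with the usual convention that s ^ oo is 0 if s <= 1 and
   oo otherwise; the case q = -oo does not arise for exponents. *)
Definition expow (s q : \bar R) : \bar R :=
  match q with
  | r%:E => poweR s r
  | +oo => if s <= 1 then 0 else +oo
  | -oo => 0
  end.

Definition modular p (g : 'rV[R]_n -> \bar R) : \bar R :=
  \int[torus_measure]_x expow `|g x| (p x).

(* The norm is +oo for functions outside the space. *)
Definition luxemburg p (g : 'rV[R]_n -> \bar R) : \bar R :=
  ereal_inf [set l%:E | l in [set l : R |
    (0 < l)%R /\ modular p (fun x => l^-1%:E * g x) <= 1]].

Definition weighted_norm p w (f : 'rV[R]_n -> R[i]) : \bar R :=
  luxemburg p (fun x => (w x * cmod (f x))%:E).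

Definition cube (c : 'rV[R]_n) (h : R) : set 'rV[R]_n :=
  [set x | forall j, (c 0 j <= x 0 j < c 0 j + h)%R].

(* L^1_loc(T^n) is L^1 of the torus. The inverse of w is taken in \bar R, where
   0^-1 = +oo. The cubes are half-open, so that [0,1)^n is one of them. *)
Definition muckenhoupt p w :=
  [/\ forall x, (0 <= w x)%R,
      torus_measure.-integrable setT (EFin \o w) &
      ereal_sup [set r | exists c h, [/\ (0 < h)%R, cube c h `<=` unit_cube &
        r = (torus_measure (cube c h))^-1 *
            luxemburg p (fun x => (w x * \1_(cube c h) x)%:E) *
            luxemburg (fun x => hoelder_conjugate (p x))
              (fun x => (w x)%:E^-1 * (\1_(cube c h) x)%:E)]] < +oo].

End VariableExponent.

(* Main.v *)
(* Since m < -n, the sum of <xi>^m over Z^n converges, so |Af| is bounded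
   pointwise by a constant times the L^1 norm of f: neither the oscillation of
   the phase nor the derivatives of the symbol matter. By Young's inequality,
   ||f||_1 <= 2 ||w f||_p ||1/w||_p', hence
   ||w Af||_p <= C ||w||_p ||1/w||_p' ||w f||_p, and the Muckenhoupt condition on
   the cube [0,1)^n says that ||w||_p ||1/w||_p' is finite; both factors are
   finite because neither vanishes. *)
Require Import Defs.
From mathcomp Require Import all_boot all_order all_algebra.
From mathcomp Require Import complex.
From mathcomp Require Import all_classical all_reals all_analysis.
From mathcomp Require Import measurable_realfun ess_sup_inf.
From mathcomp Require Import ring lra zify.

Set Implicit Arguments.
Unset Strict Implicit.
Unset Printing Implicit Defensive.

Import Order.TTheory GRing.Theory Num.Theory.
Import numFieldNormedType.Exports.

Local Open Scope classical_set_scope.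
Local Open Scope ring_scope.

(** * Summability of negative powers of the Japanese bracket over Z^n *)

Section LatticeSum.
Variables (R : realType) (n : nat).
Implicit Types (xi : 'rV[int]_n) (s : seq 'rV[int]_n).

Lemma japanese_ge1 xi : 1 <= japanese xi :> R.
Proof. by rewrite -[leLHS]sqrtr1 ler_wsqrtr// lerDl sqr_ge0. Qed.

Lemma coord_le_japanese xi j : `|xi 0 j|%:~R <= japanese xi :> R.
Proof.
rewrite intr_norm -sqrtr_sqr ler_wsqrtr// /enorm sqr_sqrtr; last first.
  by apply: sumr_ge0 => i _; exact: sqr_ge0.
rewrite (bigD1 j)//= mxE addrCA lerDl addr_ge0//.
by apply: sumr_ge0 => i _; exact: sqr_ge0.
Qed.

(** Shifting every coordinate by [M] embeds the box into the row vectors over ['I_(2 * M).+1], which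
    are counted by [card_mx]. *)
Lemma size_lattice_box (M : nat) s : uniq s ->
  (forall xi, xi \in s -> forall j, `|xi 0 j| <= M%:Z) ->
  (size s <= (2 * M).+1 ^ n)%N.
Proof.
move=> us sM.
pose h xi : 'rV['I_(2 * M).+1]_n := \row_j inord (absz (xi 0 j + M%:Z)).
rewrite -(size_map h) -[X in (X ^ n)%N]card_ord -[X in (_ ^ X)%N]mul1n -card_mx.
have uh : uniq (map h s).
  rewrite map_inj_in_uniq// => x y xs ys /matrixP hxy.
  apply/rowP => j; have := hxy 0 j; rewrite !mxE => /(congr1 val)/=.
  have := sM _ xs j; have := sM _ ys j => yM xM.
  rewrite !inordK; lia.
by rewrite -(card_uniqP uh) max_card.
Qed.

(* Splitting along the cubes of half-side 2^k, the k-th shell has at most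
   8^n 2^(kn) points, each contributing at most 2^(km). *)
Lemma sum_japanese_box (m : R) (K : nat) s : m <= 0 -> uniq s ->
  (forall xi, xi \in s -> forall j, `|xi 0 j| <= (2 ^ K)%N%:Z) ->
  \sum_(xi <- s) japanese xi `^ m <=
  8 ^+ n * (1 + \sum_(0 <= k < K) (2 `^ (m + n%:R)) ^+ k).
Proof.
have cst (t : seq 'rV[int]_n) (c : R) : \sum_(xi <- t) c = c *+ size t.
  by rewrite big_const_seq count_predT iter_addr_0.
move=> m0; elim: K s => [|K IH] s us sK.
  (* For [K = 0] the box has at most 3^n <= 8^n points, and each term is at most 1 because
     [m <= 0]. *)
  rewrite big_geq// addr0 mulr1.
  apply: (@le_trans _ _ (\sum_(xi <- s) 1)).
    apply: ler_sum => xi _; rewrite -[leRHS](powRr0 (japanese xi)).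
    by rewrite ler_powR// japanese_ge1.
  rewrite cst.
  have := size_lattice_box us sK; rewrite -(ler_nat R) => /le_trans; apply.
  rewrite natrX lerXn2r// ?nnegrE ?ler0n//; lra.
pose small xi := [forall j, `|xi 0 j| <= (2 ^ K)%N%:Z].
rewrite (bigID small)/= big_nat_recr//= addrA [leRHS]mulrDr lerD//.
  rewrite -big_filter; apply: IH; first exact: filter_uniq.
  by move=> xi; rewrite mem_filter => /andP[/forallP].
rewrite -big_filter.
set t := seq.filter _ s.
apply: (@le_trans _ _ (\sum_(xi <- t) (2 ^+ K) `^ m)).
  rewrite big_seq [leRHS]big_seq; apply: ler_sum => xi.
  rewrite mem_filter /small negb_forall => /andP[/existsP[j xj] _].
  have K0 : (0 : R) < 2 ^+ K by rewrite exprn_gt0.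
  have Kxi : 2 ^+ K <= japanese xi :> R.
    apply: le_trans (coord_le_japanese xi j).
    rewrite -natrX (_ : (2 ^ K)%:R = (2 ^ K)%N%:Z%:~R)// ler_int.
    by rewrite -ltNge in xj; exact: ltW.
  rewrite -(opprK m) !(powRN _ (- m)) lef_pV2 ?posrE ?powR_gt0//; last first.
    exact: lt_le_trans Kxi.
  by rewrite ge0_ler_powR ?oppr_ge0 ?nnegrE ?(ltW K0)// (le_trans _ Kxi)// ltW.
rewrite cst -[leLHS]mulr_natl.
have -> : (2 `^ (m + n%:R)) ^+ K = (2 ^+ K) `^ m * (2 ^+ K) ^+ n :> R.
  rewrite -!powR_mulrn ?exprn_ge0 ?powR_ge0// -!powRrM -powRD; last first.
    by rewrite pnatr_eq0 implybT.
  by congr (_ `^ _); ring.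
rewrite mulrCA [leLHS]mulrC ler_pM2l ?powR_gt0 ?exprn_gt0// -exprMn.
have /size_lattice_box : uniq t by exact: filter_uniq.
have tK xi : xi \in t -> forall j, `|xi 0 j| <= (2 ^ K.+1)%N%:Z.
  by rewrite mem_filter => /andP[_ /sK].
move=> /(_ _ tK); rewrite -(ler_nat R) => /le_trans; apply.
rewrite natrX lerXn2r// ?nnegrE ?ler0n ?mulr_ge0 ?exprn_ge0//.
have : (1 : R) <= 2 ^+ K by rewrite exprn_ege1// ler1n.
(* The factor 8 arises here: a side of the larger box has 4 * 2^K + 1 <= 8 * 2^K lattice points. *)
suff -> : (2 * 2 ^ K.+1).+1%:R = 4 * 2 ^+ K + 1 :> R by lra.
by rewrite -natr1 natrM natrX exprS; ring.
Qed.

(** Every finite set of lattice points lies in some box of half-side 2^M, and the dyadic bound is a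
    geometric sum of ratio 2^(m+n) < 1, hence bounded uniformly in M. *)
Lemma esum_japanese_lty (m : R) : m < - n%:R ->
  (\esum_(xi in [set: 'rV[int]_n]) (japanese xi `^ m)%:E < +oo :> \bar R)%E.
Proof.
move=> mn; set r : R := 2 `^ (m + n%:R).
have m0 : m <= 0 by rewrite ltW// (lt_le_trans mn)// oppr_le0.
have r0 : 0 <= r by exact: powR_ge0.
have r1 : r < 1.
  rewrite -(powRr0 2) /r /powR ?pnatr_eq0/= ltr_expR mul0r pmulr_llt0.
    by rewrite -ltrBrDr sub0r.
  by rewrite ln_gt0// ltr1n.
apply: (@le_lt_trans _ _ (8 ^+ n * (1 + (1 - r)^-1))%:E); last exact: ltry.
apply: ge_ereal_sup => _ [X [finX _] <-].
rewrite fsbig_finite//= sumEFin lee_fin.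
set s : seq 'rV[int]_n := finmap.enum_fset (fset_set X).
(* The sum of all absolute coordinates dominates each of them, and M < 2^M. *)
pose M := (\sum_(xi <- s) \sum_j absz (xi 0%R j))%N.
have sM xi : xi \in s -> forall j, `|xi 0 j| <= (2 ^ M)%N%:Z.
  move=> xis j; have : (absz (xi 0%R j) <= M)%N.
    rewrite /M (big_rem xi)//= (bigD1 j)//= -addnA leq_addr//.
  have := ltn_expl M (isT : 1 < 2)%N; lia.
apply: (le_trans (sum_japanese_box m0 (finmap.fset_uniq _) sM)).
rewrite ler_pM2l ?exprn_gt0// lerD2l.
have -> : \sum_(0 <= k < M) r ^+ k = (1 - r ^+ M) / (1 - r).
  have /(congr1 (@^~ M)) := geometric_seriesE 1 (negbT (lt_eqF r1)).
  rewrite /series/= mul1r => <-; apply: eq_bigr => i _; rewrite mul1r//.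
rewrite -[leRHS]mul1r ler_wpM2r ?invr_ge0 ?subr_ge0 ?(ltW r1)//.
by rewrite lerBlDr lerDl exprn_ge0.
Qed.
End LatticeSum.

(** * Continuous functions on R^n are Borel measurable *)

Section RowVectorMeasurability.
Variables (R : realType) (n : nat).

(** The sigma-algebra is generated by the coordinates, not by the open sets. So [f] is written as
    the pointwise limit of its values at the points rounded down to the grid of mesh 1/(k+1); each
    approximant is constant on countably many measurable boxes. *)
Lemma continuous_rV_measurable (f : 'rV[R]_n -> R) :
  continuous f -> measurable_fun setT f.
Proof.
move=> cf.
pose N (k : nat) (x : 'rV[R]_n) : 'rV[int]_n :=
  \row_j Num.floor (k.+1%:R * x 0 j).
pose pi k (z : 'rV[int]_n) : 'rV[R]_n := k.+1%:R^-1 *: map_mx intr z.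
apply: (@measurable_fun_cvg _ _ _ _ (fun k x => f (pi k (N k x)))).
  move=> k _ Y mY; rewrite setTI.
  have -> : (fun x => f (pi k (N k x))) @^-1` Y =
      \bigcup_(z in [set: 'rV[int]_n]) [set x | N k x = z /\ Y (f (pi k z))].
    apply/seteqP; split=> [x Yx|x [z _ /= [<-]]//].
    by exists (N k x).
  apply: countable_bigcupT_measurable => // z.
  have [Yz|nYz] := pselect (Y (f (pi k z))); last first.
    rewrite [X in measurable X](_ : _ = set0); first exact: measurable0.
    by apply/seteqP; split => x //= [].
  rewrite [X in measurable X](_ : _ = \bigcap_(j in [set: 'I_n])
      (fun x : 'rV[R]_n => x 0 j) @^-1`
      [set` `[(z 0 j)%:~R / k.+1%:R, (z 0 j + 1)%:~R / k.+1%:R[]).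
    apply: fin_bigcap_measurable => // j _; rewrite -[X in measurable X]setTI.
    by apply: (@measurable_coord R n j) => //; exact: measurable_itv.
  have floorP (t : R) (i : int) : (Num.floor (k.+1%:R * t) == i) =
      (t \in `[i%:~R / k.+1%:R, (i + 1)%:~R / k.+1%:R[).
    by rewrite in_itv/= floor_eq ler_pdivrMr// ltr_pdivlMr// ![t * _]mulrC.
  apply/seteqP; split=> x /=.
    by move=> [Nx _] j _ /=; rewrite -floorP -Nx mxE.
  move=> xz; split=> //; apply/rowP => j; rewrite mxE; apply/eqP.
  by rewrite floorP; exact: xz.
move=> x _; apply: (cvg_comp (fun k => pi k (N k x)) f _ (cf x)).
apply/cvgrPdist_le => e e0.
near=> k.
rewrite [leLHS]mx_normrE; apply: bigmax_le; first exact: ltW.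
move=> [i j] _ /=; rewrite ord1 !mxE.
apply: (@le_trans _ _ (k.+1%:R^-1)); last first.
  by apply: ltW; near: k; exact: (near_infty_natSinv_lt (PosNum e0)).
have /andP[fl fu] := floor_itv (k.+1%:R * x 0 j).
have k0 : (0 : R) < k.+1%:R by rewrite ltr0n.
rewrite -[X in X - _](mulKf (lt0r_neq0 k0)) -mulrBr normrM gtr0_norm ?invr_gt0//.
rewrite ler_piMr ?invr_ge0 ?(ltW k0)// ger0_norm ?subr_ge0// lerBlDl.
by rewrite intrD in fu; exact: ltW.
Unshelve. all: by end_near. Qed.
End RowVectorMeasurability.

(** * Monotonicity of the integral and measurability of inverses and powers *)

Section Integral.
Context d (T : measurableType d) (R : realType).
Variable mu : {measure set T -> \bar R}.
Local Open Scope ereal_scope.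
Import HBNNSimple.

(** The integral of a nonnegative function is a supremum over the simple functions below it, and a
    larger function has more of them. This form applies to integrands built from [fio], whose
    measurability is not established. *)
Lemma ge0_le_integralT (f g : T -> \bar R) :
  (forall x, 0 <= f x) -> (forall x, f x <= g x) ->
  \int[mu]_x f x <= \int[mu]_x g x.
Proof.
move=> f0 fg; rewrite !ge0_integralTE//; last first.
  by move=> x; exact: le_trans (fg x).
apply: le_ereal_sup => _ [h hf <-].
exists h => // x; exact: le_trans (fg x).
Qed.

(** The identity 1/f = f * (f^2)^(-1) reduces the claim to a fixed real power; where f vanishes both
    sides are 0, since 0^-1 = 0. *)
Lemma measurable_fun_inv (f : T -> R) :
  measurable_fun setT f -> measurable_fun setT (fun x => (f x)^-1%R).
Proof.
move=> mf.
have -> : (fun x => (f x)^-1)%R = (fun x => f x * ((f x) ^+ 2) `^ (-1))%R.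
  apply/funext => x; rewrite powR_inv1 ?sqr_ge0//.
  have [->|f0] := eqVneq (f x) 0%R; first by rewrite mul0r invr0.
  by rewrite expr2 invfM mulrA divff// mul1r.
apply: measurable_funM => //.
apply: (measurableT_comp (measurable_powR _)).
exact: measurable_funX.
Qed.

Lemma measurable_fun_powR (f g : T -> R) :
  measurable_fun setT f -> measurable_fun setT g ->
  measurable_fun setT (fun x => f x `^ g x)%R.
Proof.
move=> mf mg; rewrite /powR.
apply: measurable_fun_ifT => /=.
- exact: measurable_fun_eqr.
- rewrite [X in measurable_fun _ X](_ : _ =
      (fun x => if g x == 0 then 1 else 0)%R); last first.
    by apply/funext => x; case: ifP.
  by apply: measurable_fun_ifT => //; exact: measurable_fun_eqr.
- apply: measurableT_comp => //; apply: measurable_funM => //.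
  exact: measurableT_comp.
Qed.

End Integral.

(** * Pointwise inequalities for powers with extended real exponent *)

Section VariableExponentIneq.
Variable R : realType.
Local Open Scope ereal_scope.
Implicit Types s t p q : \bar R.

Lemma expow_ge0 s q : 0 <= expow s q.
Proof.
by case: q => [r| |]//=; [exact: poweR_ge0|case: ifP => // _; exact: le0y].
Qed.

Lemma le_expow s t q : 0 < q -> 0 <= s -> s <= t -> expow s q <= expow t q.
Proof.
case: q => [r| |]//= r0 s0 st; last first.
  case: ifP => [_|/negbT s1]; first by case: ifP => // _; exact: le0y.
  by case: ifP => // t1; rewrite (le_trans st t1) in s1.
move: s t s0 st => [s| |] [t| |]//=; rewrite ?lee_fin => s0 st.
- rewrite ge0_ler_powR ?nnegrE//; last exact: le_trans st.
  by rewrite ltW.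
- by rewrite gt_eqF// leey.
Qed.

(** Either s <= 1, or s <= s^q; on a space of mass 1 this lets the modular control the L^1 norm. *)
Lemma le_1Dexpow s q : 0 <= s -> 1 <= q -> s <= 1 + expow s q.
Proof.
move=> s0 q1; have [s1|s1] := leP s 1.
  by rewrite (le_trans s1)// leeDl// expow_ge0.
apply: (@le_trans _ _ (expow s q)); last by rewrite leeDr.
case: q q1 => [r| |]//=; rewrite ?lee_fin => r1; last by rewrite [s <= 1]leNgt s1/= leey.
case: s s0 s1 => [s| |]//= s0 s1.
  by rewrite lee_fin le1r_powR// ltW.
by rewrite gt_eqF// (lt_le_trans ltr01 r1).
Qed.

(** Young's inequality with the factors 1/p and 1/p' bounded by 1. Both exponents are finite and
    positive, so an infinite [s] or [t] makes the right-hand side infinite. *)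
Lemma young_expow s t p : 0 <= s -> 0 <= t -> 1 < p -> p < +oo ->
  s * t <= expow s p + expow t (hoelder_conjugate p).
Proof.
case: p => [p| |]// s0 t0; rewrite lte_fin => p1 _.
have p0 : (0 < p)%R by exact: lt_trans p1.
have p10 : (0 < p - 1)%R by rewrite subr_gt0.
have -> : hoelder_conjugate p%:E = (p / (p - 1))%:E.
  by rewrite /hoelder_conjugate/= eqe gt_eqF// -EFinD inver gt_eqF.
have q0 : (0 < p / (p - 1))%R by exact: divr_gt0.
case: s s0 => [s| |]//= s0; last first.
  by rewrite gt_eqF// addye ?leey// gt_eqF// (lt_le_trans _ (poweR_ge0 _ _)).
case: t t0 => [t| |]//= t0; last by rewrite gt_eqF// addey ?leey.
rewrite -EFinM -EFinD lee_fin; rewrite !lee_fin in s0 t0.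
apply: (le_trans (conjugate_powR s0 t0 p0 q0 _)).
  by rewrite invf_div mulrBl mul1r divff ?gt_eqF// addrC subrK.
have q1 : (1 <= p / (p - 1))%R by rewrite ler_pdivlMr// mul1r gerBl.
by rewrite lerD// ler_piMr ?powR_ge0// invf_le1// ltW.
Qed.

End VariableExponentIneq.

(** * Measurability of variable powers and of the conjugate exponent *)

Section MeasurableExpow.
Context d (T : measurableType d) (R : realType).
Local Open Scope ereal_scope.

Lemma measurable_expow (s q : T -> \bar R) :
  (forall x, 0 <= s x) -> measurable_fun setT s -> measurable_fun setT q ->
  measurable_fun setT (fun x => expow (s x) (q x)).
Proof.
move=> s0 ms mq.
(* The last branch is reached only where both arguments are finite, so the default values of [fine]
   do no harm. *)
rewrite [X in measurable_fun _ X](_ : _ = fun x =>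
    if q x == +oo then if s x <= 1 then 0 else +oo
    else if q x == -oo then 0
    else if s x == +oo then if fine (q x) == 0%R then 1 else +oo
    else (fine (s x) `^ fine (q x))%:E); last first.
  apply/funext => x; case: (q x) => [r| |]//=.
  by case: (s x) (s0 x) => [t| |].
have mfin (f : T -> \bar R) : measurable_fun setT f ->
    measurable_fun setT (fun x => fine (f x)).
  by move=> mf; exact: measurableT_comp.
apply: measurable_fun_ifT; first exact: measurable_fun_eqe.
  by apply: measurable_fun_ifT => //; exact: measurable_fun_lee.
apply: measurable_fun_ifT => //; first exact: measurable_fun_eqe.
apply: measurable_fun_ifT; first exact: measurable_fun_eqe.
  by apply: measurable_fun_ifT => //; apply: measurable_fun_eqr => //; exact: mfin.
by apply/measurable_EFinP/measurable_fun_powR; exact: mfin.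
Qed.

Lemma measurable_hoelder_conjugate (p : T -> \bar R) :
  measurable_fun setT p ->
  measurable_fun setT (fun x => hoelder_conjugate (p x)).
Proof.
move=> mp.
rewrite [X in measurable_fun _ X](_ : _ = fun x =>
    if p x == +oo then 1 else if p x == -oo then 0 else if p x == 0 then -oo
    else if fine (p x) == 1%R then +oo
    else (fine (p x) / (fine (p x) - 1))%:E); last first.
  apply/funext => x; rewrite /hoelder_conjugate.
  case: (p x) => [r| |]//=; case: ifP => // /negbT.
  rewrite eqe => r0; rewrite -EFinD inver subr_eq0.
  by case: eqP => // ->; rewrite mul1e.
have mfin : measurable_fun setT (fun x => fine (p x)) by exact: measurableT_comp.
apply: measurable_fun_ifT => //; first exact: measurable_fun_eqe.
apply: measurable_fun_ifT => //; first exact: measurable_fun_eqe.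
apply: measurable_fun_ifT => //; first exact: measurable_fun_eqe.
apply: measurable_fun_ifT => //; first exact: measurable_fun_eqr.
apply/measurable_EFinP/measurable_funM => //; apply: measurable_fun_inv.
exact: measurable_funB.
Qed.

End MeasurableExpow.

(** * Null sets of the torus measure *)

Section TorusNull.
Variables (R : realType) (n : nat).
Local Open Scope ereal_scope.

Lemma measurable_box (a b : 'I_n -> R) :
  measurable [set x : 'rV[R]_n | forall j, (a j <= x 0 j < b j)%R].
Proof.
rewrite [X in measurable X](_ : _ = \bigcap_(j in [set: 'I_n])
    (fun x : 'rV[R]_n => x 0%R j) @^-1` [set` `[a j, b j[%R]).
  apply: fin_bigcap_measurable => // j _; rewrite -[X in measurable X]setTI.
  by apply: (@measurable_coord R n j) => //; exact: measurable_itv.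
apply/seteqP; split=> x /=.
  by move=> xB j _ /=; rewrite in_itv /=; exact: xB.
by move=> xB j; have := xB j Logic.I; rewrite /= in_itv.
Qed.

Lemma unit_cubeE : unit_cube = cube 0 1 :> set 'rV[R]_n.
Proof.
by apply/seteqP; split=> x /= xB j; have := xB j; rewrite !mxE add0r.
Qed.

Lemma torus_measure_unit_cube : torus_measure (@unit_cube R n) = 1.
Proof.
rewrite torus_measure_box; last by move=> j; rewrite lexx ler01.
by rewrite big1// => j _; rewrite subr0.
Qed.

(** [torus_measure] is a probability on all of R^n, and the cube already has mass 1. *)
Lemma ae_unit_cube : \forall x \ae (@torus_measure R n), unit_cube x.
Proof.
exists (~` unit_cube); split => //; first by apply: measurableC; exact: measurable_box.
by rewrite probability_setC ?torus_measure_unit_cube ?subee//; exact: measurable_box.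
Qed.

(** The point lies in slabs of the cube, thin in one coordinate, whose measures tend to 0. A
    coordinate must exist: for n = 0 the measure is a Dirac mass. *)
Lemma ae_neq (x0 : 'rV[R]_n) : (0 < n)%N -> unit_cube x0 ->
  \forall x \ae (@torus_measure R n), x != x0.
Proof.
move=> n0 x0Q; pose j0 := Ordinal n0; pose c : R := x0 0%R j0.
have c1 : (0 < 1 - c)%R by rewrite subr_gt0; case/andP: (x0Q j0).
have c0 : (0 <= c)%R by case/andP: (x0Q j0).
(* With this thickness the slab starting at [c] stays inside the cube. *)
pose e k : R := ((1 - c) / k.+1%:R)%R.
have e0 k : (0 < e k)%R by rewrite divr_gt0.
have e1 k : (c + e k <= 1)%R.
  by rewrite -lerBrDl ler_pdivrMr// ler_peMr ?ler1n// ltW.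
pose A k := [set x : 'rV[R]_n | forall j : 'I_n,
  ((if j == j0 then c else 0) <= x 0 j < (if j == j0 then c + e k else 1))%R].
have mA k : measurable (A k) by exact: measurable_box.
have muA k : torus_measure (A k) = (e k)%:E.
  rewrite torus_measure_box; last first.
    move=> j; case: ifP => _; last by rewrite lexx ler01.
    by rewrite c0 e1 lerDl ltW.
  rewrite (bigD1 j0)// eqxx big1 => [|j /= /negbTE ->]; last by rewrite subr0.
  by rewrite /= mulr1 addrAC subrr add0r.
exists (\bigcap_k A k); split.
- exact: bigcapT_measurable.
- apply/eqP; rewrite eq_le measure_ge0 andbT; apply/lee_addgt0Pr => r r0.
  rewrite add0e.
  have [k ek] : exists k, (e k <= r)%R.
    exists (Num.truncn ((1 - c) / r)).
    by rewrite ler_pdivrMr// mulrC -ler_pdivrMr// ltW// truncnS_gt.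
  apply: (@le_trans _ _ (e k)%:E); last by rewrite lee_fin.
  rewrite -muA le_measure ?inE//; first exact: bigcapT_measurable.
  by move=> x; apply.
- move=> x /= /negP; rewrite negbK => /eqP -> k _ j.
  have /andP[xl xu] := x0Q j.
  by case: eqP => [->|_]; rewrite ?xl ?xu// lexx ltrDl e0.
Qed.

Lemma torus_measureT :
  (torus_measure : {measure set 'rV[R]_n -> \bar R}) setT = 1.
Proof. exact: probability_setT. Qed.

Lemma torus_measure_ae_ex (P : set 'rV[R]_n) :
  (\forall x \ae (@torus_measure R n), P x) -> exists x, P x.
Proof.
move=> aeP; apply: contrapT => /forallNP nP.
have : (torus_measure : probability _ R).-negligible [set: 'rV[R]_n].
  by apply: negligibleS aeP => x _ /=; exact: nP.
move/negligibleP => /(_ measurableT).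
by have := torus_measureT => /= -> /eqP; rewrite onee_eq0.
Qed.

End TorusNull.

(** * The modular, the Luxemburg norm and Hoelder's inequality *)

Section LuxemburgNorm.
Variables (R : realType) (n : nat).
Local Open Scope ereal_scope.
Local Notation mu := (@torus_measure R n).
Implicit Types p q g u v : 'rV[R]_n -> \bar R.

Lemma measurable_modular_integrand p g : measurable_fun setT p ->
  measurable_fun setT g -> measurable_fun setT (fun x => expow `|g x| (p x)).
Proof. by move=> mp mg; apply: measurable_expow => //; exact: measurableT_comp. Qed.

Lemma ae_eq_modular p g1 g2 : measurable_fun setT p ->
  measurable_fun setT g1 -> measurable_fun setT g2 ->
  (\forall x \ae mu, g1 x = g2 x) -> modular p g1 = modular p g2.
Proof.
move=> mp mg1 mg2 g12; apply: ge0_ae_eq_integral => //.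
- exact: measurable_modular_integrand.
- exact: measurable_modular_integrand.
- by move=> x _; exact: expow_ge0.
- by move=> x _; exact: expow_ge0.
- by apply: filterS g12 => x -> _.
Qed.

Lemma le_modular p g1 g2 : (forall x, 0 < p x) ->
  (forall x, `|g1 x| <= `|g2 x|) -> modular p g1 <= modular p g2.
Proof.
move=> p0 g12; apply: ge0_le_integralT => x; first exact: expow_ge0.
exact: le_expow.
Qed.

(** Integrate g/l <= 1 + (g/l)^q: the constant 2 is the total mass 1 plus the modular. *)
Lemma integral_le_modular q g (l : R) : measurable_fun setT q ->
  measurable_fun setT g -> (\forall x \ae mu, 1 <= q x) ->
  (forall x, 0 <= g x) -> (0 < l)%R ->
  modular q (fun x => l^-1%:E * g x) <= 1 -> \int[mu]_x g x <= (2 * l)%:E.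
Proof.
move=> mq mg q1 g0 l0 mod1.
have lV0 : (0 <= l^-1)%R by rewrite invr_ge0 ltW.
have mlg : measurable_fun setT (fun x => l^-1%:E * g x).
  by apply: emeasurable_funM => //; exact: measurable_cst.
rewrite -[X in (2 * X)%R]invrK EFinM lee_pdivlMr ?invr_gt0// muleC.
rewrite -ge0_integralZl_EFin//.
apply: (@le_trans _ _ (\int[mu]_x (1 + expow `|l^-1%:E * g x| (q x)))).
  apply: ae_ge0_le_integral => //.
  - by move=> x _; rewrite mule_ge0.
  - by move=> x _; rewrite adde_ge0// expow_ge0.
  - by apply: emeasurable_funD => //; exact: measurable_modular_integrand.
  apply: filterS q1 => x q1 _; rewrite gee0_abs ?mule_ge0//.
  by rewrite le_1Dexpow// mule_ge0.
rewrite ge0_integralD//; last 2 first.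
- by move=> x _; exact: expow_ge0.
- exact: measurable_modular_integrand.
rewrite integral_cst// torus_measureT mule1 (natrD _ 1 1) EFinD.
by rewrite leeD2l.
Qed.

(** Integrating Young's inequality for u/l1 and v/l2, each modular contributes at most 1. Admissible
    constants replace the norms, so no infimum has to be attained. *)
Lemma hoelder_modular p u v (l1 l2 : R) : measurable_fun setT p ->
  measurable_fun setT u -> measurable_fun setT v ->
  (\forall x \ae mu, 1 < p x < +oo) ->
  (forall x, 0 <= u x) -> (forall x, 0 <= v x) -> (0 < l1)%R -> (0 < l2)%R ->
  modular p (fun x => l1^-1%:E * u x) <= 1 ->
  modular (fun x => hoelder_conjugate (p x)) (fun x => l2^-1%:E * v x) <= 1 ->
  \int[mu]_x (u x * v x) <= (2 * (l1 * l2))%:E.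
Proof.
move=> mp mu_ mv p1 u0 v0 l10 l20 mod1 mod2.
have lV0 : (0 <= (l1 * l2)^-1)%R by rewrite invr_ge0 mulr_ge0// ltW.
have mlu : measurable_fun setT (fun x => l1^-1%:E * u x).
  by apply: emeasurable_funM => //; exact: measurable_cst.
have mlv : measurable_fun setT (fun x => l2^-1%:E * v x).
  by apply: emeasurable_funM => //; exact: measurable_cst.
have muv : measurable_fun setT (fun x => u x * v x) by exact: emeasurable_funM.
have mp' := measurable_hoelder_conjugate mp.
have lu0 x : 0 <= l1^-1%:E * u x by rewrite mule_ge0// lee_fin invr_ge0 ltW.
have lv0 x : 0 <= l2^-1%:E * v x by rewrite mule_ge0// lee_fin invr_ge0 ltW.
rewrite -[X in (2 * X)%R]invrK EFinM lee_pdivlMr ?invr_gt0 ?mulr_gt0// muleC.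
rewrite -ge0_integralZl_EFin//; last by move=> x _; rewrite mule_ge0.
apply: (@le_trans _ _ (\int[mu]_x (expow `|l1^-1%:E * u x| (p x) +
    expow `|l2^-1%:E * v x| (hoelder_conjugate (p x))))).
  apply: ae_ge0_le_integral => //.
  - by move=> x _; rewrite !mule_ge0.
  - by apply: emeasurable_funM => //; exact: measurable_cst.
  - by move=> x _; rewrite adde_ge0// expow_ge0.
  - by apply: emeasurable_funD => //; exact: measurable_modular_integrand.
  apply: filterS p1 => x /andP[p1 py] _; rewrite !gee0_abs//.
  apply: le_trans (young_expow (lu0 x) (lv0 x) p1 py).
  by rewrite invfM EFinM muleACA.
rewrite ge0_integralD//.
- by rewrite (natrD _ 1 1) EFinD leeD.
- by move=> x _; exact: expow_ge0.
- exact: measurable_modular_integrand.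
- by move=> x _; exact: expow_ge0.
- exact: measurable_modular_integrand.
Qed.

Lemma luxemburg_ge0 p g : 0 <= luxemburg p g.
Proof. by apply: le_ereal_inf_tmp => _ [l [l0 _] <-]; rewrite lee_fin ltW. Qed.

(** A zero norm provides arbitrarily small admissible l, and the integral of g is at most 2l; hence
    g = 0 almost everywhere, against its positivity. *)
Lemma luxemburg_gt0 q g : measurable_fun setT q -> measurable_fun setT g ->
  (\forall x \ae mu, 1 <= q x) -> (forall x, 0 <= g x) ->
  (\forall x \ae mu, 0 < g x) -> 0 < luxemburg q g.
Proof.
move=> mq mg q1 g0 gpos; rewrite lt0e luxemburg_ge0 andbT; apply/eqP => L0.
have : \int[mu]_x `|g x| = 0.
  under eq_integral do rewrite gee0_abs//.
  apply/eqP; rewrite eq_le integral_ge0// andbT; apply/lee_addgt0Pr => r r0.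
  rewrite add0e.
  have /ereal_inf_lt[_ [l [l0 mod1] <-]] : luxemburg q g < (r / 2)%:E.
    by rewrite L0 lte_fin divr_gt0.
  rewrite lte_fin => lr.
  apply: le_trans (integral_le_modular mq mg q1 g0 l0 mod1) _.
  by rewrite lee_fin -ler_pdivlMl// mulrC ltW.
move/(ae_eq_integral_abs _ measurableT mg) => gae.
have [x [gx0 gx]] : exists x, g x = 0 /\ 0 < g x.
  by apply: torus_measure_ae_ex; apply: filterS2 gae gpos => x /(_ Logic.I).
by rewrite gx0 ltxx in gx.
Qed.

Lemma luxemburg_lty p g : luxemburg p g < +oo ->
  exists2 l : R, (0 < l)%R & modular p (fun x => l^-1%:E * g x) <= 1.
Proof. by move=> /ereal_inf_lt[_ [l [l0 mod1] _] _]; exists l. Qed.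

Lemma luxemburg_le p g (l : R) : (0 < l)%R ->
  modular p (fun x => l^-1%:E * g x) <= 1 -> luxemburg p g <= l%:E.
Proof. by move=> l0 mod1; apply: ereal_inf_lbound; exists l. Qed.

End LuxemburgNorm.

(** * Bounds for absolutely summable families over Z^n *)

Section AbsoluteSum.
Variables (R : realType) (n : nat).
Implicit Types (F : 'rV[int]_n -> R) (z : R[i]).

Lemma normr_Re_le_cmod z : `|complex.Re z| <= cmod z.
Proof. by case: z => x y /=; rewrite -sqrtr_sqr ler_wsqrtr// lerDl sqr_ge0. Qed.

Lemma normr_Im_le_cmod z : `|complex.Im z| <= cmod z.
Proof. by case: z => x y /=; rewrite -sqrtr_sqr ler_wsqrtr// lerDr sqr_ge0. Qed.

Lemma cmod_le_ReIm z : cmod z <= `|complex.Re z| + `|complex.Im z|.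
Proof.
case: z => x y /=; rewrite /cmod /=.
rewrite -[leRHS]ger0_norm ?addr_ge0// -sqrtr_sqr ler_wsqrtr//.
rewrite sqrrD !real_normK ?num_real//.
by rewrite addrAC lerDl mulrn_wge0// mulr_ge0.
Qed.

Lemma cmod_ge0 z : 0 <= cmod z.
Proof. exact: le_trans (normr_Re_le_cmod z). Qed.

Lemma cmod_expi (t : R) : cmod (expi t) = 1.
Proof. by rewrite /cmod /= cos2Dsin2 sqrtr1. Qed.

(** The sums of the positive and negative parts both lie in [0, S], so [fine] loses nothing and
    their difference lies in [-S, S]. *)
Lemma normr_rsum_le F (G : 'rV[int]_n -> R) (S : R) :
  (forall xi, `|F xi| <= G xi) ->
  (\esum_(xi in setT) (G xi)%:E <= S%:E)%E -> `|rsum F| <= S.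
Proof.
move=> FG GS; rewrite /rsum.
have boundF (H : 'rV[int]_n -> \bar R) :
    (forall xi, (0 <= H xi <= (G xi)%:E)%E) ->
    0 <= fine (\esum_(xi in setT) H xi)%E <= S.
  move=> H0G; have esum0 : (0 <= \esum_(xi in setT) H xi)%E.
    by apply: esum_ge0 => xi _; case/andP: (H0G xi).
  have esumS : (\esum_(xi in setT) H xi <= S%:E)%E.
    by apply: le_trans GS; apply: le_esum => xi _; case/andP: (H0G xi).
  by rewrite fine_ge0//= -lee_fin fineK// ge0_fin_numE// (le_lt_trans esumS) ?ltry.
have /andP[p0 pS] : 0 <= fine (\esum_(xi in setT) (EFin \o F)^\+ xi)%E <= S.
  apply: boundF => xi; rewrite funepos_ge0/= funeposE/= ge_max !lee_fin.
  by rewrite (le_trans (ler_norm _) (FG xi)) (le_trans _ (FG xi)).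
have /andP[q0 qS] : 0 <= fine (\esum_(xi in setT) (EFin \o F)^\- xi)%E <= S.
  apply: boundF => xi; rewrite funeneg_ge0/= funenegE/= ge_max !lee_fin.
  by rewrite (le_trans (ler_norm _))// ?normrN// (le_trans _ (FG xi)).
by rewrite ler_norml; lra.
Qed.

Lemma cmod_csum_le (F : 'rV[int]_n -> R[i]) (G : 'rV[int]_n -> R) (S : R) :
  (forall xi, cmod (F xi) <= G xi) ->
  (\esum_(xi in setT) (G xi)%:E <= S%:E)%E -> cmod (csum F) <= 2 * S.
Proof.
move=> FG GS; apply: (le_trans (cmod_le_ReIm _)) => /=.
rewrite [leRHS]mulr_natl mulr2n lerD// (normr_rsum_le _ GS)// => xi.
  exact: le_trans (normr_Re_le_cmod _) (FG xi).
exact: le_trans (normr_Im_le_cmod _) (FG xi).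
Qed.

Lemma esumZ_le (c S : R) (G : 'rV[int]_n -> R) : 0 <= c ->
  (\esum_(xi in setT) (G xi)%:E <= S%:E)%E ->
  (\esum_(xi in setT) (c * G xi)%:E <= (c * S)%:E)%E.
Proof.
move=> c0 GS; apply: ge_ereal_sup => _ [X [finX XT] <-].
have : (\sum_(xi \in X) (G xi)%:E <= S%:E)%E.
  by apply: le_trans GS; apply: ereal_sup_ubound; exists X.
by rewrite !fsbig_finite//= !sumEFin -mulr_sumr !lee_fin; exact: ler_wpM2l.
Qed.

End AbsoluteSum.

(** * Pointwise bound of the operator by the L^1 norm *)

Section FourierIntegralOperatorBound.
Variables (R : realType) (n : nat).
Local Notation mu := (@torus_measure R n).

Lemma mderiv0 (f : 'rV[R]_n -> R) : mderiv (fun=> 0%N) f = f.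
Proof. by rewrite /mderiv; elim: (enum _) => //= j s ->. Qed.

Lemma mdiff0 (c : 'rV[int]_n -> R[i]) : mdiff (fun=> 0%N) c = c.
Proof. by rewrite /mdiff; elim: (enum _) => //= j s ->. Qed.

Lemma csmooth_measurable (f : 'rV[R]_n -> R[i]) : csmooth f ->
  measurable_fun setT (fun x => complex.Re (f x)) /\
  measurable_fun setT (fun x => complex.Im (f x)).
Proof.
move=> [sRe sIm]; split; apply: continuous_rV_measurable.
- by case: (sRe [::]).
- by case: (sIm [::]).
Qed.

Lemma measurable_cmod (f : 'rV[R]_n -> R[i]) :
  measurable_fun setT (fun x => complex.Re (f x)) ->
  measurable_fun setT (fun x => complex.Im (f x)) ->
  measurable_fun setT (fun x => cmod (f x)).
Proof.
move=> mRe mIm.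
rewrite [X in measurable_fun _ X](_ : _ = fun x =>
    Num.sqrt (complex.Re (f x) ^+ 2 + complex.Im (f x) ^+ 2)); last first.
  by apply/funext => x; case: (f x).
apply: (@measurableT_comp _ _ _ _ _ _ (@Num.sqrt R)).
  by apply: continuous_measurable_fun; exact: sqrt_continuous.
by apply: measurable_funD; exact: measurable_funX.
Qed.

(** The real bound [I] makes the integral of [g] finite, so [fine] returns its true value. *)
Lemma normr_fine_integral_le (g : 'rV[R]_n -> R) (h : 'rV[R]_n -> R) (I : R) :
  measurable_fun setT g -> (forall x, `|g x| <= h x) ->
  (\int[mu]_x (h x)%:E <= I%:E)%E -> `|fine (\int[mu]_x (g x)%:E)%E| <= I.
Proof.
move=> mg gh hI.
have intI : (`|\int[mu]_x (g x)%:E| <= I%:E)%E.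
  apply: le_trans hI; apply: le_trans (le_abse_integral _ measurableT _) _.
    exact/measurable_EFinP.
  by apply: ge0_le_integralT => x; rewrite ?lee_fin//= gh.
have fin : (\int[mu]_x (g x)%:E)%E \is a fin_num.
  by rewrite fin_num_abs (le_lt_trans intI)// ltry.
by case: integral fin intI => //= r _; rewrite lee_fin.
Qed.

(** The exponential has modulus 1; the factor 2 comes from bounding real and imaginary parts
    separately. *)
Lemma cmod_fourier_le (f : 'rV[R]_n -> R[i]) (xi : 'rV[int]_n) (I : R) :
  csmooth f -> (\int[mu]_x (cmod (f x))%:E <= I%:E)%E ->
  cmod (fourier f xi) <= 2 * I.
Proof.
move=> /csmooth_measurable[mRe mIm] fI.
pose g x := expi (- (2 * pi * dot x xi)) * f x.
have gle x : cmod (g x) <= cmod (f x).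
  by rewrite /g /cmod ComplexField.Normc.normcM -/(cmod _) cmod_expi mul1r.
have mdot : measurable_fun setT (fun x : 'rV[R]_n => - (2 * pi * dot x xi)).
  apply: measurable_funN; apply: measurable_funM => //.
  apply: measurable_sum => j; apply: measurable_funM => //.
  exact: measurable_coord.
have mcos : measurable_fun setT (fun x : 'rV[R]_n => cos (- (2 * pi * dot x xi))).
  apply: (@measurableT_comp _ _ _ _ _ _ (@cos R)) => //.
  by apply: continuous_measurable_fun; exact: continuous_cos.
have msin : measurable_fun setT (fun x : 'rV[R]_n => sin (- (2 * pi * dot x xi))).
  apply: (@measurableT_comp _ _ _ _ _ _ (@sin R)) => //.
  by apply: continuous_measurable_fun; exact: continuous_sin.
apply: (le_trans (cmod_le_ReIm _)) => /=; rewrite [leRHS]mulr_natl mulr2n lerD//.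
  apply: normr_fine_integral_le fI; last first.
    by move=> x; exact: le_trans (normr_Re_le_cmod _) (gle x).
  rewrite [X in measurable_fun _ X](_ : _ = fun x =>
      cos (- (2 * pi * dot x xi)) * complex.Re (f x) -
      sin (- (2 * pi * dot x xi)) * complex.Im (f x)); last first.
    by apply/funext => x; case: (f x).
  by apply: measurable_funB; exact: measurable_funM.
apply: normr_fine_integral_le fI; last first.
  by move=> x; exact: le_trans (normr_Im_le_cmod _) (gle x).
rewrite [X in measurable_fun _ X](_ : _ = fun x =>
    cos (- (2 * pi * dot x xi)) * complex.Im (f x) +
    sin (- (2 * pi * dot x xi)) * complex.Re (f x)); last first.
  by apply/funext => x; case: (f x).
by apply: measurable_funD; exact: measurable_funM.
Qed.

(** Subtracting the floors of the coordinates moves any point into the cube. *)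
Lemma one_periodic_unit_cube (U : Type) (g : 'rV[R]_n -> U) (P : U -> Prop) :
  one_periodic g -> (forall x, unit_cube x -> P (g x)) -> forall x, P (g x).
Proof.
move=> pg Pg x; rewrite -(pg x (- \row_j Num.floor (x 0 j))); apply: Pg => j.
have /andP[fl fu] := floor_itv (x 0 j).
by rewrite !mxE intrN; rewrite intrD in fu; lra.
Qed.

Lemma one_periodic_fio (phi : 'rV[R]_n -> 'rV[int]_n -> R)
    (a : 'rV[R]_n -> 'rV[int]_n -> R[i]) (f : 'rV[R]_n -> R[i]) :
  (forall xi, one_periodic (fun x => expi (2 * pi * phi x xi))) ->
  (forall xi, one_periodic (a ^~ xi)) -> one_periodic (fio phi a f).
Proof.
move=> pphi pa x l; rewrite /fio; congr csum; apply/funext => xi.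
by have /= -> := pphi xi x l; have /= -> := pa xi x l.
Qed.

(** On the cube the symbol estimate of order zero bounds each term by C <xi>^m * 2I, which is
    summable; periodicity extends the bound to R^n. The constant has one factor 2 from the Fourier
    coefficient and one from [csum]. *)
Lemma cmod_fio_le (m rho delta : R) (phi : 'rV[R]_n -> 'rV[int]_n -> R)
    (a : 'rV[R]_n -> 'rV[int]_n -> R[i]) :
  m < - n%:R -> symbol_class m rho delta a ->
  (forall xi, one_periodic (fun x => expi (2 * pi * phi x xi))) ->
  exists2 K : R, 0 < K & forall (f : 'rV[R]_n -> R[i]) (I : R), csmooth f ->
    (\int[mu]_x (cmod (f x))%:E <= I%:E)%E ->
    forall x, cmod (fio phi a f x) <= K * I.
Proof.
move=> mn [pa _ /(_ (fun=> 0%N) (fun=> 0%N))[C C0 aC]] pphi.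
have {}aC x xi : unit_cube x -> cmod (a x xi) <= C * japanese xi `^ m.
  move=> xQ; have := aC x xi xQ.
  rewrite /cmderiv !mderiv0 !mdiff0 /mlength big1// !mulr0 subr0 addr0.
  by case: (a x xi).
set Sj := (\esum_(xi in [set: 'rV[int]_n]) (japanese xi `^ m)%:E : \bar R)%E.
have Sj0 : (0 <= Sj)%E by apply: esum_ge0 => xi _; rewrite lee_fin powR_ge0.
have Sfin : Sj \is a fin_num by rewrite ge0_fin_numE// esum_japanese_lty.
(* Adding 1 makes [S], and with it the final constant, positive. *)
pose S := fine Sj + 1.
have S0 : 0 < S by rewrite ltr_wpDl// fine_ge0.
have SjS : (Sj <= S%:E)%E by rewrite -(fineK Sfin) lee_fin lerDl.
exists (2 * (C * 2 * S)); first by rewrite !mulr_gt0.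
move=> f I sf fI.
have I0 : 0 <= I.
  rewrite -lee_fin; apply: le_trans fI; apply: integral_ge0 => x _.
  by rewrite lee_fin cmod_ge0.
apply: (one_periodic_unit_cube (g := fio phi a f)
  (P := fun z => cmod z <= 2 * (C * 2 * S) * I)) => [|x xQ].
  exact: one_periodic_fio.
have -> : 2 * (C * 2 * S) * I = 2 * (C * 2 * I * S) by ring.
apply: (cmod_csum_le (G := fun xi => C * 2 * I * japanese xi `^ m)); last first.
  by apply: esumZ_le => //; rewrite !mulr_ge0// ltW.
move=> xi; rewrite /cmod !ComplexField.Normc.normcM -!/(cmod _) cmod_expi mul1r.
have -> : C * 2 * I * japanese xi `^ m = C * japanese xi `^ m * (2 * I) by ring.
by apply: ler_pM; rewrite ?cmod_ge0 ?aC ?cmod_fourier_le.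
Qed.

End FourierIntegralOperatorBound.

(** * Positivity of the power weight *)

Section PowerWeight.
Variables (R : realType) (n : nat).

Lemma enorm_gt0 (y : 'rV[R]_n) : y != 0 -> 0 < enorm y.
Proof.
move=> y0; rewrite sqrtr_gt0 lt0r sumr_ge0 ?andbT; last first.
  by move=> j _; exact: sqr_ge0.
apply: contraNneq y0 => /eqP; rewrite psumr_eq0; last by move=> j _; exact: sqr_ge0.
move=> /allP y0; apply/eqP/rowP => j; rewrite mxE; apply/eqP.
by have := y0 j (mem_index_enum j); rewrite sqrf_eq0.
Qed.

(** On the cube, which has full measure, every factor is positive away from the finitely many points
    [xs k], and these are null. *)
Lemma ae_power_weight_gt0 (w : 'rV[R]_n -> R) (beta : R) (betas : 'I_n -> R)
    (xs : 'I_n -> 'rV[R]_n) : (0 < n)%N -> (forall k, unit_cube (xs k)) ->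
  (forall x, unit_cube x ->
    w x = (1 + enorm x) `^ beta * \prod_k enorm (x - xs k) `^ betas k) ->
  \forall x \ae (@torus_measure R n), 0 < w x.
Proof.
move=> n0 xsQ wE.
have neq : \forall x \ae (@torus_measure R n), forall k, x != xs k.
  by apply: filter_forall => k; exact: ae_neq.
apply: filterS2 (ae_unit_cube R n) neq => x xQ neq.
rewrite wE// mulr_gt0//; first by rewrite powR_gt0// ltr_wpDr// sqrtr_ge0.
by apply: prodr_gt0 => k _; rewrite powR_gt0// enorm_gt0// subr_eq0.
Qed.

End PowerWeight.

(** * Boundedness on the weighted variable-exponent space *)

Theorem theorem3p4 (R : realType) (n : nat) (n_gt0 : (0 < n)%N)
  (m rho delta : R)
  (delta_ge0 : 0 <= delta) (delta_lt_rho : delta < rho) (rho_le1 : rho <= 1)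
  (m_lt : m < - (n%:R + 1))
  (a : 'rV[R]_n -> 'rV[int]_n -> R[i])
  (a_symbol : symbol_class m rho delta a)
  (phi : 'rV[R]_n -> 'rV[int]_n -> R)
  (phi_phase : phase_function phi)
  (phi_periodic : forall xi, one_periodic (fun x => expi (2 * pi * phi x xi)))
  (phi_bounded : exists2 C : R, 0 < C &
    forall (alpha : 'I_n -> nat) (x : 'rV[R]_n) (xi : 'rV[int]_n),
      unit_cube x -> `|mderiv alpha (phi ^~ xi) x| <= C)
  (p : 'rV[R]_n -> \bar R)
  (p_log : log_hoelder p)
  (p_minus : (1 < ess_inf torus_measure p)%E)
  (p_plus : (ess_sup torus_measure p < +oo)%E)
  (r0 : R) (pinf : \bar R)
  (r0_gt0 : 0 < r0) (pinf_gt0 : (0 < pinf)%E)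
  (p_far : forall x, unit_cube x -> r0 <= enorm x -> p x = pinf)
  (w : 'rV[R]_n -> R)
  (beta : R) (betas : 'I_n -> R) (xs : 'I_n -> 'rV[R]_n)
  (xs_torus : forall k, unit_cube (xs k))
  (w_periodic : one_periodic w)
  (w_form : forall x, unit_cube x ->
    w x = (1 + enorm x) `^ beta * \prod_k enorm (x - xs k) `^ betas k)
  (w_Ap : muckenhoupt p w)
  (betas_bounds : forall k,
    (- (n%:R%:E / p (xs k)) < (betas k)%:E)%E /\
    ((betas k)%:E < n%:R%:E / hoelder_conjugate (p (xs k)))%E)
  (beta_bounds :
    (- (n%:R%:E / pinf) < (beta + \sum_k betas k)%:E)%E /\
    ((beta + \sum_k betas k)%:E < n%:R%:E / hoelder_conjugate pinf)%E) :
  exists2 C' : R, 0 < C' &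
    forall f : 'rV[R]_n -> R[i], smooth_torus f ->
      (weighted_norm p w (fio phi a f) <= C'%:E * weighted_norm p w f)%E.
Proof.
have [[mp _ p0] _] := p_log.
have p1y : \forall x \ae (@torus_measure R n), (1 < p x < +oo)%E.
  apply: filterS2 (ess_inf_le torus_measure p) (ess_sup_ge torus_measure p).
  by move=> x pm pp; rewrite (lt_le_trans p_minus)// (le_lt_trans pp).
have p1 : \forall x \ae (@torus_measure R n), (1 <= p x)%E.
  by apply: filterS p1y => x /andP[/ltW].
have q1 : \forall x \ae (@torus_measure R n), (1 <= hoelder_conjugate (p x))%E.
  by apply: filterS p1 => x; exact: hoelder_conj_ge1.
have mq := measurable_hoelder_conjugate mp.
have [w0 /measurable_int/measurable_EFinP mw Ap] := w_Ap.
have aew := ae_power_weight_gt0 n_gt0 xs_torus w_form.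
have aeQ := ae_unit_cube R n; rewrite unit_cubeE in aeQ.
pose Q : set 'rV[R]_n := cube 0 1.
have mQ : measurable Q by exact: measurable_box.
have m1Q : measurable_fun setT (\1_Q : 'rV[R]_n -> R) by exact: measurable_indic.
(* [u] and [v] are the two functions of the Muckenhoupt condition on the cube [Q]; almost everywhere
   they equal w and 1/w. *)
pose u x := (w x * \1_Q x)%:E.
pose v x := ((w x)%:E^-1 * (\1_Q x)%:E)%E.
have mu_ : measurable_fun setT u by exact/measurable_EFinP/measurable_funM.
have mv : measurable_fun setT v.
  apply: emeasurable_funM; last exact/measurable_EFinP.
  (* The inverse is taken in the extended reals, so it is +oo at zeros of [w]. *)
  rewrite [X in measurable_fun _ X](_ : _ = fun x =>
      if w x == 0 then +oo%E else ((w x)^-1)%:E); last first.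
    by apply/funext => x; rewrite inver.
  apply: measurable_fun_ifT => //; first exact: measurable_fun_eqr.
  by apply/measurable_EFinP; exact: measurable_fun_inv.
have u0 x : (0 <= u x)%E by rewrite lee_fin mulr_ge0.
have v0 x : (0 <= v x)%E by rewrite mule_ge0// inve_ge0 lee_fin.
have aeu : \forall x \ae (@torus_measure R n), u x = (w x)%:E.
  by apply: filterS aeQ => x xQ; rewrite /u indicE mem_set// mulr1.
have aev : \forall x \ae (@torus_measure R n), v x = (w x)^-1%:E.
  apply: filterS2 aeQ aew => x xQ wx; rewrite /v indicE mem_set// mule1.
  by rewrite inver gt_eqF.
have Lu : (0 < luxemburg p u)%E.
  by apply: luxemburg_gt0 => //; apply: filterS2 aeu aew => x ->.
have Lv : (0 < luxemburg (fun x => hoelder_conjugate (p x)) v)%E.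
  apply: luxemburg_gt0 => //; apply: filterS2 aev aew => x -> wx.
  by rewrite lte_fin invr_gt0.
have LuLv : (luxemburg p u * luxemburg (fun x => hoelder_conjugate (p x)) v < +oo)%E.
  apply: le_lt_trans Ap; apply: ereal_sup_ubound; exists 0, 1; split => //.
    by rewrite unit_cubeE.
  by rewrite -unit_cubeE torus_measure_unit_cube inve1 mul1e unit_cubeE.
(* If this factor were infinite, the positive factor [Lv] would make the product infinite; the
   second norm is treated symmetrically. *)
have [l l0 ul] : exists2 l : R, 0 < l & (modular p (fun x => l^-1%:E * u x) <= 1)%E.
  apply: luxemburg_lty; rewrite ltey; apply: contraTneq LuLv => ->.
  by rewrite gt0_mulye.
have [l2 l20 vl2] : exists2 l : R, 0 < l &
    (modular (fun x => hoelder_conjugate (p x)) (fun x => l^-1%:E * v x) <= 1)%E.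
  apply: luxemburg_lty; rewrite ltey; apply: contraTneq LuLv => ->.
  by rewrite gt0_muley.
have [|K K0 AK] := cmod_fio_le _ a_symbol phi_periodic.
  by rewrite (lt_trans m_lt)// ltrN2 ltrDl.
have C'0 : 0 < K * (2 * l2) * l by rewrite !mulr_gt0.
exists (K * (2 * l2) * l) => // f [_ sf].
(* The norm of f is an infimum, so it suffices to treat each constant [l1] admissible for w f; an
   infinite norm is then covered as well. *)
rewrite -lee_pdivrMl//; apply: le_ereal_inf_tmp => _ [l1 [l10 fl1] <-].
rewrite lee_pdivrMl// -EFinM.
have [mRe mIm] := csmooth_measurable sf.
have mf := measurable_cmod mRe mIm.
have mwf : measurable_fun setT (fun x => (w x * cmod (f x))%:E).
  exact/measurable_EFinP/measurable_funM.
have wf0 x : (0 <= (w x * cmod (f x))%:E)%E by rewrite lee_fin mulr_ge0// cmod_ge0.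
(* Hoelder's inequality applies to |f| = (w |f|) (1/w), valid almost everywhere. *)
have f1 : (\int[torus_measure]_x (cmod (f x))%:E <= (2 * (l1 * l2))%:E)%E.
  apply: le_trans (hoelder_modular mp mwf mv p1y wf0 v0 l10 l20 fl1 vl2).
  apply: ae_ge0_le_integral => //.
  - by move=> x _; rewrite lee_fin cmod_ge0.
  - exact/measurable_EFinP.
  - by move=> x _; rewrite mule_ge0.
  - exact: emeasurable_funM.
  apply: filterS2 aev aew => x -> wx _.
  by rewrite -EFinM lee_fin mulrAC divff ?mul1r// gt_eqF.
have {}AK := AK f _ sf f1.
set c := K * (2 * (l1 * l2)).
have c0 : 0 < c by rewrite !mulr_gt0.
have -> : K * (2 * l2) * l * l1 = c * l by rewrite /c; ring.
(* Since |Af| <= c everywhere, w |Af| / (c l) <= w / l pointwise, so c l is admissible for w Af. *)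
apply: luxemburg_le; first exact: mulr_gt0.
apply: le_trans ul.
(* [u] vanishes off the cube, where w Af need not; the comparison is therefore made with w itself,
   which has the same modular. *)
have <- : modular p (fun x => (l^-1%:E * (w x)%:E)%E) =
    modular p (fun x => (l^-1%:E * u x)%E).
  apply: ae_eq_modular => //.
  - by apply: emeasurable_funM => //; exact/measurable_EFinP.
  - exact: emeasurable_funM.
  - by apply: filterS aeu => x ->.
apply: le_modular => // x; rewrite -!EFinM !abse_EFin lee_fin.
have lw0 : 0 <= l^-1 * w x by rewrite mulr_ge0// invr_ge0 ltW.
have -> : (c * l)^-1 * (w x * cmod (fio phi a f x)) =
    l^-1 * w x * (c^-1 * cmod (fio phi a f x)) by rewrite invfM; ring.
have cA0 : 0 <= c^-1 * cmod (fio phi a f x).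
  by rewrite mulr_ge0 ?cmod_ge0// invr_ge0 ltW.
rewrite (ger0_norm lw0) (ger0_norm (mulr_ge0 lw0 cA0)).
by rewrite ler_piMr// ler_pdivrMl// mulr1 AK.
Qed.
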